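(* There exists a sequence $\omega\colon\mathbb{N}\to\{0,1\}$ which is almost periodic but not eventually strongly almost periodic.
   Context: For a sequence $\omega\colon\mathbb{N}\to\Sigma$ over a finite alphabet $\Sigma$, write $\omega[i,j]=\omega(i)\omega(i+1)\dots\omega(j)$ and $\omega[i,\infty)$ for the suffix $\omega(i)\omega(i+1)\dots$. A nonempty finite string $x$ is a factor of $\omega$ if $x=\omega[i,j]$ for some $i\le j$; a factor of length $l$ is a string $\omega[i,i+l-1]$. The sequence $\omega$ is almost periodic if for every factor $x$ of $\omega$ that occurs in $\omega$ infinitely many times there is a number $l$ such that every factor of $\omega$ of length $l$ contains an occurrence of $x$. It is strongly almost periodic if for every factor $x$ of $\omega$ there is $l$ such that every factor of $\omega$ of length $l$ contains an occurrence of $x$. It is eventually strongly almost periodic if some suffix $\omega[n,\infty)$ is strongly almost periodic. *)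

(* Defs.v *)
From mathcomp Require Import all_boot.

Set Implicit Arguments.
Unset Strict Implicit.
Unset Printing Implicit Defensive.

Section Sequences.

Variable Sigma : finType.
Implicit Types (w : nat -> Sigma) (x y : seq Sigma).

(* w[i, j], both endpoints included; empty if j < i. *)
Definition segment w (i j : nat) : seq Sigma := [seq w k | k <- index_iota i j.+1].

Definition suffix_from w (n : nat) : nat -> Sigma := fun k => w (n + k).

Definition factor w x : Prop := exists i j : nat, i <= j /\ x = segment w i j.

Definition occurs_infinitely_often w x : Prop :=
  forall N : nat, exists i j : nat, [/\ N <= i, i <= j & x = segment w i j].

(* Factors are nonempty, so without [0 < l] the choice l = 0 would make the
   condition vacuous. *)
Definition recurs_in_bounded_windows w x : Prop :=
  exists l : nat, 0 < l /\
    forall y, factor w y -> size y = l -> infix x y.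

Definition almost_periodic w : Prop :=
  forall x, factor w x -> occurs_infinitely_often w x ->
    recurs_in_bounded_windows w x.

Definition strongly_almost_periodic w : Prop :=
  forall x, factor w x -> recurs_in_bounded_windows w x.

Definition eventually_strongly_almost_periodic w : Prop :=
  exists n : nat, strongly_almost_periodic (suffix_from w n).

End Sequences.

(* Main.v *)
Require Import Defs.
From mathcomp Require Import all_boot.
From mathcomp Require Import zify.

(** Write [v] for the 2-adic valuation.  The sequence is the period-doubling
    word [odd (v i)], flipped at every power of two.  Since the flips sit at
    places of growing valuation, a window of length [2^K] far enough to the
    right cannot tell a flipped place from an unflipped one of valuation [K] or
    [K+1], so it recurs along an arithmetic progression.  On the other hand,
    the flipped values at [2^n, 2*2^n, 3*2^n, 4*2^n] form a pattern
    which the period-doubling word itself avoids, and arbitrarily long windows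
    contain no power of two. *)

Section Windows.

Variable Sigma : finType.
Implicit Types (w : nat -> Sigma) (x y : seq Sigma).

Lemma segment_iota w i l : segment w i (i + l) = [seq w k | k <- iota i l.+1].
Proof. by rewrite /segment /index_iota -addnS addKn. Qed.

Lemma infix_window w a b l m :
  a <= b -> b + m <= a + l ->
  infix [seq w k | k <- iota b m] [seq w k | k <- iota a l].
Proof.
move=> ab bl; apply/infixP.
exists [seq w k | k <- iota a (b - a)], [seq w k | k <- iota (b + m) (a + l - (b + m))].
rewrite -!map_cat -iotaD; congr map.
have {1}-> : l = (b - a) + (m + (a + l - (b + m))) by lia.
by rewrite iotaD subnKC.
Qed.

Lemma infix_windowP w (w' : nat -> Sigma) a b l m :
  infix [seq w' k | k <- iota b m] [seq w k | k <- iota a l] ->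
  exists c, [/\ a <= c, c + m <= a + l & forall k, k < m -> w' (b + k) = w (c + k)].
Proof.
case/infixP=> s1 [s2 E].
have sz : l = size s1 + (m + size s2).
  by move/(congr1 size): E; rewrite !size_cat !size_map !size_iota.
exists (a + size s1); split; [lia | lia | move=> k km].
have /(congr1 (fun s => nth (w' 0) s (size s1 + k))) := E.
rewrite (nth_map 0) ?size_iota; last by lia.
rewrite nth_iota; last by lia.
rewrite nth_cat ltnNge leq_addr /= addKn nth_cat size_map size_iota km.
by rewrite (nth_map 0) ?size_iota // nth_iota // addnA => <-.
Qed.

End Windows.

(** A valuation below [k] is also that of the gcd with [p ^ k], which depends only on the
    residue. *)
Lemma logn_modn_pfactor p k m n :
  prime p -> m = n %[mod p ^ k] -> ~~ (p ^ k %| m) -> logn p m = logn p n.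
Proof.
move=> pr_p mn Nm.
have Nn : ~~ (p ^ k %| n) by rewrite /dvdn -mn.
have m_gt0 : 0 < m by case: m Nm {mn} => //; rewrite dvdn0.
have n_gt0 : 0 < n by case: n Nn {mn} => //; rewrite dvdn0.
have pk_gt0 : 0 < p ^ k by rewrite expn_gt0 prime_gt0.
have : logn p (gcdn m (p ^ k)) = logn p (gcdn n (p ^ k)).
  by rewrite -gcdn_modl mn gcdn_modl.
rewrite !logn_gcd // pfactorK //.
move: Nm Nn; rewrite !pfactor_dvdn //; lia.
Qed.

Lemma logn2_odd k u : logn 2 (2 ^ k * u.*2.+1) = k.
Proof.
rewrite lognM ?expn_gt0 // pfactorK // lognE /= dvdn2 /=.
by rewrite odd_double /= addn0.
Qed.

(** If [2 ^ n] does not divide [a], a shift by [2 * 2 ^ n] keeps the valuation. Otherwise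
    [a = q * 2 ^ n], and [q, q + 2] or [q + 1, q + 3] are both odd, so one of the two pairs has
    valuation [n] at both places. *)
Lemma period_doubling_pattern n a :
  let d i := odd (logn 2 i) in
  d a != d (a + 2 * 2 ^ n) -> d (a + 2 ^ n) != d (a + 3 * 2 ^ n) -> False.
Proof.
move=> d; rewrite /d.
have [/dvdnP[q ->]|Na] := boolP (2 ^ n %| a); last first.
  by rewrite (@logn_modn_pfactor 2 n a (a + 2 * 2 ^ n)) ?eqxx // [a + _]addnC modnMDl.
have -> : q * 2 ^ n + 2 * 2 ^ n = 2 ^ n * q.+2 by rewrite -mulnDl mulnC; congr (_ * _); lia.
have -> : q * 2 ^ n + 2 ^ n = 2 ^ n * q.+1 by rewrite mulnC mulnS addnC.
have -> : q * 2 ^ n + 3 * 2 ^ n = 2 ^ n * q.+3 by rewrite -mulnDl mulnC; congr (_ * _); lia.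
rewrite [q * _]mulnC -(odd_double_half q); case: (odd q); rewrite ?add1n ?add0n -?doubleS.
  by rewrite !logn2_odd eqxx.
by rewrite !logn2_odd eqxx.
Qed.

Definition flipped_period_doubling (i : nat) : bool :=
  odd (logn 2 i) (+) (i == 2 ^ logn 2 i).

Local Notation f := flipped_period_doubling.

Lemma flipped_exp n : f (2 ^ n) = ~~ odd n.
Proof. by rewrite /f pfactorK // eqxx addbT. Qed.

Lemma flipped_odd k u : 0 < u -> f (2 ^ k * u.*2.+1) = odd k.
Proof.
move=> u0; rewrite /f logn2_odd -[X in _ == X]muln1 eqn_pmul2l ?expn_gt0 //.
by case: u u0 => // u _; rewrite addbF.
Qed.

Lemma flipped_between m i : 2 ^ m < i -> i < 2 ^ m.+1 -> f i = odd (logn 2 i).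
Proof.
move=> lo hi; rewrite /f; case: eqP => [E|_]; last by rewrite addbF.
by move: lo hi; rewrite E !ltn_exp2l // ltnS; case: ltngtP.
Qed.

(** Powers of two from [2 ^ k] on are multiples of [2 ^ k], so neither place is flipped. *)
Lemma flipped_modn k i j :
  2 ^ k <= i -> 2 ^ k <= j -> i = j %[mod 2 ^ k] -> ~~ (2 ^ k %| i) -> f i = f j.
Proof.
have nflip m : 2 ^ k <= m -> ~~ (2 ^ k %| m) -> f m = odd (logn 2 m).
  move=> km; rewrite /f; case: eqP => [E|_]; last by rewrite addbF.
  by rewrite E dvdn_exp2l // -(@leq_exp2l 2) // -E.
move=> ki kj ij Ni; have Nj : ~~ (2 ^ k %| j) by rewrite /dvdn -ij.
by rewrite !nflip // (@logn_modn_pfactor 2 k i j).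
Qed.

Lemma flipped_recurs k i :
  2 ^ k <= i ->
  exists q P, 0 < P /\ forall t c, c < 2 ^ k -> f (q + P * t + c) = f (i + c).
Proof.
move=> ki; have k0 : 0 < 2 ^ k by rewrite expn_gt0.
have [r rk ir] : exists2 r, r < 2 ^ k & 2 ^ k %| i + r.
  (* The outer reduction matters when [2 ^ k] divides [i]: it turns [2 ^ k] into 0. *)
  exists ((2 ^ k - i %% 2 ^ k) %% 2 ^ k); first by rewrite ltn_mod.
  rewrite /dvdn modnDmr -modnDml subnKC ?modnn //.
  by rewrite ltnW // ltn_mod.
(* The unique multiple of [2^k] in the window is imitated by the places
   [3 * 2^M, 5 * 2^M, ...], with [M] of the parity dictated by its letter. *)
have [M kM oM] : exists2 M, k <= M & odd M = f (i + r).
  case: (odd k =P f (i + r)) => E; first by exists k.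
  by exists k.+1 => //=; case: (odd k) E; case: (f _).
have le : 2 ^ k <= 2 ^ M by rewrite leq_exp2l.
exists (3 * 2 ^ M - r), (2 ^ M.+1); split; first by rewrite expn_gt0.
move=> t c ck.
have dvP : 2 ^ k %| 2 ^ M by rewrite dvdn_exp2l.
have Er : 3 * 2 ^ M - r + 2 ^ M.+1 * t + r = 2 ^ M * (t.+1).*2.+1.
  by rewrite expnS -muln2; nia.
have Ecr : i + c = 3 * 2 ^ M - r + 2 ^ M.+1 * t + c %[mod 2 ^ k].
  apply/eqP; rewrite eqn_modDr -(eqn_modDr r) Er.
  by rewrite (eqP ir) eq_sym; apply: dvdn_mulr.
have [ic|Nic] := boolP (2 ^ k %| i + c); last first.
  symmetry; apply: flipped_modn Ecr Nic; lia.
have -> : c = r.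
  have : i + c == i + r %[mod 2 ^ k] by rewrite (eqP ic) (eqP ir).
  by rewrite eqn_modDl !modn_small // => /eqP.
by rewrite Er flipped_odd.
Qed.

Definition omega (i : nat) : 'I_2 := inord (f i).

Lemma omega_inj i j : omega i = omega j -> f i = f j.
Proof.
move/(congr1 val); rewrite /= !inordK; last 2 first.
- by case: (f _).
- by case: (f _).
by case: (f i); case: (f j).
Qed.

Lemma omega_almost_periodic : almost_periodic omega.
Proof.
move=> x [i0 [j0 [ij0 x0]]] io.
(* An occurrence this far out satisfies [flipped_recurs] with [k = size x], and [x] is shorter than
   [2 ^ size x]. *)
have [i [j [xi /subnKC ij xE]]] := io (2 ^ size x).
move: (j - i) ij => m jE; move: xE; rewrite -jE segment_iota => xE.
have sx : size x = m.+1 by rewrite xE size_map size_iota.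
have [q [P [P0 qP]]] := @flipped_recurs _ _ xi.
(* A window starting at [a] contains the copy of [x] at [q + P * (a %/ P).+1], which lies between
   [a] and [a + q + P]. *)
exists (q + P + m.+1); split; first by lia.
move=> _ [a [b [/subnKC <- ->]]]; rewrite segment_iota size_map size_iota => ->.
have -> : x = [seq omega k | k <- iota (q + P * (a %/ P).+1) m.+1].
  rewrite xE; apply: (@eq_from_nth _ (omega 0)); rewrite !size_map !size_iota // => c cm.
  rewrite !(nth_map 0) ?size_iota // !nth_iota // /omega qP //.
  by rewrite sx (ltn_trans cm) // ltn_expl.
have := divn_eq a P; have := ltn_pmod a P0.
by move=> ? ?; apply: infix_window; rewrite mulnS; lia.
Qed.

Lemma omega_not_eventually : ~ eventually_strongly_almost_periodic omega.
Proof.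
case=> N sap.
have N_lt : N < 2 ^ N by rewrite ltn_expl.
(* In [omega] this factor runs from [2 ^ N] to [4 * 2 ^ N]; it survives in the suffix because
   [N < 2 ^ N]. *)
have [|l [l0 rec]] := sap (segment (suffix_from omega N) (2 ^ N - N) (2 ^ N - N + 3 * 2 ^ N)).
  by exists (2 ^ N - N), (2 ^ N - N + 3 * 2 ^ N); rewrite leq_addr.
have lt_m : N + l < 2 ^ (N + l) by rewrite ltn_expl.
(* The window occupies the places [2 ^ m + 1] to [2 ^ m + l] of [omega]; since [l <= m < 2 ^ m], it
   meets no power of two. *)
set m := N + l in lt_m.
set b := (2 ^ m).+1 - N.
have fac : factor (suffix_from omega N) (segment (suffix_from omega N) b (b + l.-1)).
  by exists b, (b + l.-1); rewrite leq_addr.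
have := rec _ fac; rewrite !segment_iota prednK // size_map size_iota => /(_ erefl).
move=> /infix_windowP [c [lc cu E]].
have {}E s : s < 4 -> f (s.+1 * 2 ^ N) = odd (logn 2 (N + c + s * 2 ^ N)).
  move=> s4; have := E (s * 2 ^ N); rewrite /suffix_from.
  have sN : s * 2 ^ N <= 3 * 2 ^ N by rewrite leq_mul2r -ltnS s4 orbT.
  move=> /(_ _)/omega_inj; rewrite ltnS sN => /(_ isT).
  have -> : N + (2 ^ N - N + s * 2 ^ N) = s.+1 * 2 ^ N by rewrite mulSn; lia.
  rewrite addnA => ->; apply: (@flipped_between m); rewrite ?expnS; lia.
(* [2 ^ N] and [3 * 2 ^ N] share a valuation, but only the first is flipped; [2 * 2 ^ N] and
   [4 * 2 ^ N] are both flipped, with consecutive valuations. *)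
apply: (@period_doubling_pattern N (N + c)) => /=.
  have := E 0 isT; rewrite mul0n addn0 mul1n => <-; rewrite -E //.
  by rewrite flipped_exp mulnC (@flipped_odd N 1) //; case: (odd N).
have := E 1 isT; rewrite mul1n => <-; rewrite -E //.
rewrite -[2 * _]expnS (_ : 4 * 2 ^ N = 2 ^ N.+2); last by rewrite !expnS; lia.
by rewrite !flipped_exp /= negbK; case: (odd N).
Qed.

Theorem theorem1 :
  exists w : nat -> 'I_2,
    almost_periodic w /\ ~ eventually_strongly_almost_periodic w.
Proof.
exists omega; split; first exact: omega_almost_periodic.
exact: omega_not_eventually.
Qed.
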